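(* Let $R$ be a ring and $X$ an indeterminate over $R$. Assume that the polynomial ring $R[X]$ is weakly Laskerian. Then $\operatorname{Spec} R$ (with the Zariski topology) is a Noetherian topological space.
   Context: All rings are commutative with identity. For an $R$-module $M$, $\operatorname{Ass}_R M$ denotes the set of prime ideals $\mathfrak p$ of $R$ of the form $\mathfrak p=(0:_R x)$ for some $x\in M$. An $R$-module $M$ is weakly Laskerian if $\operatorname{Ass}_R(M/N)$ is a finite set for every submodule $N$ of $M$. A ring is weakly Laskerian if it is weakly Laskerian as a module over itself. A topological space is Noetherian if every ascending chain of open sets eventually stabilizes. *)

(* Defs.v *)
From HB Require Import structures.
From mathcomp Require Import all_boot all_algebra.
From mathcomp Require Import boolp classical_sets cardinality topology.

Set Implicit Arguments.
Unset Strict Implicit.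
Unset Printing Implicit Defensive.

Import GRing.Theory.
Local Open Scope classical_set_scope.
Local Open Scope ring_scope.
Local Open Scope quotient_scope.

(* Subsets of rings and modules (ideals, submodules, annihilators) are boolean
   predicates, as in ssralg and ring_quotient. By the classical axioms of boolp
   these are all the subsets, and two of them are equal as soon as they have
   the same elements. *)

(* ring_quotient only knows the additive quotient {quot N} by a subgroup; we
   view a submodule N as a subgroup and equip M / N with its R-action. *)
Section QuotientModule.
Variables (R : pzRingType) (M : lmodType R) (N : submodClosed M).

Lemma submod_oppr_closed : oppr_closed (N : {pred M}).
Proof. by move=> x Nx; rewrite -scaleN1r rpredZ. Qed.

Definition submod_zmod : zmodClosed M :=
  HB.pack (N : {pred M}) (GRing.isAddClosed.Build M N (rpred0D N))
    (GRing.isOppClosed.Build M N submod_oppr_closed).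

Definition quotient_module : Type := (Quotient.quot submod_zmod).

HB.instance Definition _ := GRing.Zmodule.on quotient_module.
HB.instance Definition _ :=
  EqQuotient.copy quotient_module (Quotient.quot submod_zmod).

Definition quotient_scale (a : R) (x : quotient_module) : quotient_module :=
  \pi_quotient_module (a *: repr x).

Lemma quotient_pi_eq (x y : M) :
  (\pi_quotient_module x = \pi_quotient_module y) <-> (x - y \in N).
Proof.
rewrite -[_ \in N]/(x - y \in submod_zmod) Quotient.idealrBE.
by split=> [->|/eqP].
Qed.

Lemma quotient_scale_pi (a : R) (x : M) :
  quotient_scale a (\pi_quotient_module x) = \pi_quotient_module (a *: x).
Proof.
apply/quotient_pi_eq; rewrite -scalerBr rpredZ //.
by apply/quotient_pi_eq; rewrite reprK.
Qed.

Lemma quotient_piD (x y : M) : \pi_quotient_module (x + y) =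
  \pi_quotient_module x + \pi_quotient_module y.
Proof. exact: (@Quotient.pi_add M submod_zmod). Qed.

Fact quotient_scaleA a b x :
  quotient_scale a (quotient_scale b x) = quotient_scale (a * b) x.
Proof. by rewrite -[x]reprK (quotient_scale_pi b) !quotient_scale_pi scalerA. Qed.

Fact quotient_scale1 : left_id 1 quotient_scale.
Proof. by move=> x; rewrite -[x]reprK quotient_scale_pi scale1r. Qed.

Fact quotient_scaleDr : right_distributive quotient_scale +%R.
Proof.
move=> a x y; rewrite -[x]reprK -[y]reprK.
by rewrite -quotient_piD !quotient_scale_pi scalerDr quotient_piD.
Qed.

Fact quotient_scaleDl x : {morph quotient_scale^~ x : a b / a + b}.
Proof.
move=> a b /=; rewrite -[x]reprK.
by rewrite !quotient_scale_pi scalerDl quotient_piD.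
Qed.

HB.instance Definition _ := GRing.Zmodule_isLmodule.Build R quotient_module
  quotient_scaleA quotient_scale1 quotient_scaleDr quotient_scaleDl.

Lemma quotient_piZ (a : R) (x : M) :
  \pi_quotient_module (a *: x) = a *: \pi_quotient_module x.
Proof. exact/esym/quotient_scale_pi. Qed.

End QuotientModule.

(* idealr_closed already contains properness (1 \notin p). *)
Definition prime_ideal (R : comNzRingType) (p : {pred R}) : Prop :=
  idealr_closed p /\ prime_idealr_closed p.

Definition annihilator (R : comNzRingType) (M : lmodType R) (x : M) :
  {pred R} := [pred a | a *: x == 0].

Definition Ass (R : comNzRingType) (M : lmodType R) : set {pred R} :=
  [set p | prime_ideal p /\ exists x : M, p = annihilator x].

Definition weakly_laskerian (R : comNzRingType) (M : lmodType R) : Prop :=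
  forall N : submodClosed M, finite_set (Ass (quotient_module N)).

Definition weakly_laskerian_ring (R : comNzRingType) : Prop :=
  weakly_laskerian R^o.

Definition Spec (R : comNzRingType) : Type := {p : {pred R} | prime_ideal p}.

Section Zariski.
Variable R : comNzRingType.

HB.instance Definition _ := gen_eqMixin (Spec R).
HB.instance Definition _ := gen_choiceMixin (Spec R).

Definition zero_locus (E : set R) : set (Spec R) :=
  [set p | forall a, E a -> a \in sval p].

Definition zariski_open : set (set (Spec R)) :=
  [set U | exists E : set R, U = ~` zero_locus E].

Fact zariski_openT : zariski_open setT.
Proof.
exists setT; apply/esym/seteqP; split=> // p _ /= /(_ 1 I).
by case: (svalP p) => -[_ /negP].
Qed.

Fact zariski_openI : setI_closed zariski_open.
Proof.
move=> _ _ [E ->] [F ->].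
exists [set c | exists a b, [/\ E a, F b & c = a * b]].
rewrite -setCU; congr (~` _); apply/seteqP; split=> -[p [[p0 p1 pD] pM]] /=.
  have pZ a u : u \in p -> a * u \in p.
    by move=> pu; rewrite -[_ * _]addr0 pD.
  by case=> pE _ [a [b [Ea Fb ->]]]; [rewrite mulrC|]; apply: pZ; exact: pE.
move=> pEF; apply: contrapT => /not_orP[].
move=> /existsNP[a /not_implyP[Ea /negP pa]].
move=> /existsNP[b /not_implyP[Fb /negP pb]].
have /pM : a * b \in p by apply: pEF; exists a, b.
by rewrite (negbTE pa) (negbTE pb).
Qed.

Fact zariski_open_bigU (I : Type) (U : I -> set (Spec R)) :
  (forall i, zariski_open (U i)) -> zariski_open (\bigcup_i U i).
Proof.
move=> /choice[E UE]; exists (\bigcup_i E i).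
rewrite (eq_bigcupr (fun i _ => UE i)) -setC_bigcap; congr (~` _).
apply/seteqP; split=> p /= pE; first by move=> a [i Ii]; exact: (pE i Ii a).
by move=> i _ a Ea; apply: pE; exists i.
Qed.

HB.instance Definition _ := isOpenTopological.Build (Spec R)
  zariski_openT zariski_openI zariski_open_bigU.

Lemma Spec_openE : @open (Spec R) = zariski_open.
Proof. by []. Qed.

End Zariski.

Definition noetherian_space (T : topologicalType) : Prop :=
  forall U : nat -> set T,
    (forall n, open (U n)) -> (forall n, U n `<=` U n.+1) ->
    exists m : nat, forall n : nat, (m <= n)%N -> U n = U m.

(* Main.v *)
(** Suppose the open sets [U n] increase strictly. Let [J n] be the ideal of
    functions vanishing outside [U n], pick a prime [p n] in
    [U n.+1 `\` U n], and [c n] in [J n.+1] but not in [p n]. The ideals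
    [I n = J n + c n * p n] increase and satisfy [c n \in I n.+1] and
    [(I n : c n) = p n]. Hence, modulo the ideal of the [f : {poly R}] with
    [f`_n \in I n] for all [n], the monomial [c n 'X^n] has annihilator
    [p n + ('X)], and these primes are pairwise distinct. *)

Require Import Defs.
From HB Require Import structures.
From mathcomp Require Import all_boot all_algebra.
From mathcomp Require Import boolp classical_sets cardinality.
From mathcomp Require Import topology.

Set Implicit Arguments.
Unset Strict Implicit.
Unset Printing Implicit Defensive.

Import GRing.Theory.
Local Open Scope ring_scope.
Local Open Scope quotient_scope.

Lemma constant_coef_prime_ideal (R : comNzRingType) (p : {pred R}) :
  prime_ideal p -> prime_ideal [pred f : {poly R} | f`_0 \in p].
Proof.
move=> [[p0 p1 pD] pM]; split; first split.
- by rewrite inE coef0.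
- by rewrite inE coef1.
- by move=> a u v; rewrite !inE => pu pv; rewrite coefD coef0M pD.
- by move=> u v; rewrite !inE coef0M; exact: pM.
Qed.

Section GradedIdeal.
Variables (R : comNzRingType) (I : nat -> submodClosed R^o).
Hypothesis I_incr : forall n, {subset I n <= I n.+1}.

Lemma ideal_chain_leq m n : (m <= n)%N -> {subset I m <= I n}.
Proof.
elim: n => [|n IHn]; first by rewrite leqn0 => /eqP->.
by rewrite leq_eqVlt => /predU1P[->|/IHn In x /In] //; exact: I_incr.
Qed.

Definition graded_ideal : {pred {poly R}^o} :=
  [pred f : {poly R} | `[< forall n, f`_n \in I n >]].

Lemma graded_ideal_submod_closed : GRing.submod_closed graded_ideal.
Proof.
split=> [|a u v /asboolP Iu /asboolP Iv]; apply/asboolP=> n.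
  by rewrite coef0; exact: (rpred0 (I n)).
rewrite coefD coefMr; apply: (rpredD (S := I n)) => //.
apply: (rpred_sum (S := I n)) => i _.
have /ideal_chain_leq In : (i <= n)%N by rewrite -ltnS.
exact/(rpredZ (s := I n))/In/Iu.
Qed.

HB.instance Definition _ := GRing.isSubmodClosed.Build {poly R} {poly R}^o
  graded_ideal graded_ideal_submod_closed.

(** Only degree [n] imposes a condition on [g]: below it [g * c 'X^n] has no terms, and above it
    every coefficient is a multiple of [c], which lies in [I n.+1] and hence in all later ideals. *)
Lemma annihilator_monomial (c : R) (n : nat) : c \in I n.+1 ->
  annihilator (\pi_(quotient_module graded_ideal) (c *: 'X^n : {poly R})) =
  [pred g : {poly R} | g`_0 * c \in I n].
Proof.
move=> Ic; apply/funext => g; rewrite /annihilator /=.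
rewrite -quotient_piZ -[g *: _]/(g * (c *: 'X^n)) -scalerAr.
have -> : 0 = \pi_(quotient_module graded_ideal) (0 : {poly R}^o).
  by rewrite -[X in \pi X](scale0r (0 : {poly R}^o)) quotient_piZ scale0r.
apply/eqP/idP => [/quotient_pi_eq|gI].
  rewrite subr0 => /asboolP/(_ n).
  by rewrite coefZ coefMXn ltnn subnn mulrC.
apply/quotient_pi_eq; rewrite subr0; apply/asboolP => k.
rewrite coefZ coefMXn; case: ltngtP => [_|nk|kn].
- by rewrite mulr0; exact: (rpred0 (I k)).
- by rewrite mulrC; apply/(rpredZ (s := I k))/(ideal_chain_leq nk).
- by rewrite kn subnn mulrC.
Qed.

Lemma graded_quotient_Ass_infinite (c : nat -> R) (p : nat -> {pred R}) :
  (forall n, c n \in I n.+1) ->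
  (forall n a, (a * c n \in I n) = (a \in p n)) ->
  (forall n, prime_ideal (p n)) -> injective p ->
  infinite_set (Ass (quotient_module graded_ideal)).
Proof.
move=> cI Ip p_prime p_inj Ass_fin; apply: infinite_nat.
pose P n : {pred {poly R}} := [pred f : {poly R} | f`_0 \in p n].
have P_inj : injective P.
  (* Intersecting [P n] with the constant polynomials recovers [p n]. *)
  move=> m n /(congr1 (fun A : {pred {poly R}} => fun a => a%:P \in A)) mn.
  apply: p_inj; apply/funext => a.
  by move/(congr1 (fun f => f a)): mn; rewrite !inE coefC.
suff -> : [set: nat]%classic =
    (P @^-1` Ass (quotient_module graded_ideal))%classic.
  by apply: finite_preimage Ass_fin => m n _ _ /P_inj.
apply/seteqP; split=> // n _; split; first exact: constant_coef_prime_ideal.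
exists (\pi_(quotient_module graded_ideal) (c n *: 'X^n : {poly R})).
rewrite annihilator_monomial //; apply/funext => f /=.
by rewrite Ip.
Qed.

End GradedIdeal.

Section PrimeChain.
Variables (R : comNzRingType) (J p : nat -> {pred R}) (c : nat -> R).
Hypothesis J_ideal : forall n, GRing.submod_closed (J n : {pred R^o}).
Hypothesis p_prime : forall n, prime_ideal (p n).
Hypothesis J_incr : forall n, {subset J n <= J n.+1}.
Hypothesis Jp : forall n, {subset J n <= p n}.
Hypothesis cJ : forall n, c n \in J n.+1.
Hypothesis cp : forall n, c n \notin p n.

(** The colon of [J n] by [c n] is contained in [p n], possibly strictly; adding [c n * p n] forces
    equality. *)
Definition thickened_ideal n : {pred R^o} :=
  [pred x : R | `[< exists u v, [/\ u \in J n, v \in p n & x = u + c n * v] >]].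

Lemma thickened_ideal_submod_closed n :
  GRing.submod_closed (thickened_ideal n).
Proof.
have [J0 JD] := J_ideal n; have [[p0 _ pD] _] := p_prime n.
split=> [|a _ _ /asboolP[u [v [Ju pv ->]]] /asboolP[s [t [Js pt ->]]]].
  by apply/asboolP; exists 0, 0; rewrite mulr0 addr0.
apply/asboolP; exists (a * u + s), (a * v + t); split; [exact: JD|exact: pD|].
by rewrite [a *: _]mulrDr mulrDr addrACA [c n * (a * v)]mulrCA.
Qed.

HB.instance Definition _ n := GRing.isSubmodClosed.Build R R^o
  (thickened_ideal n) (thickened_ideal_submod_closed n).

Lemma sub_thickened_ideal n : {subset J n <= thickened_ideal n}.
Proof.
move=> u Ju; apply/asboolP; exists u, 0; rewrite mulr0 addr0; split=> //.
by case: (p_prime n) => -[].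
Qed.

(** Since [c n] is in [J n.+1], both summands are already contained in [J n.+1]. *)
Lemma thickened_ideal_incr n :
  {subset thickened_ideal n <= thickened_ideal n.+1}.
Proof.
move=> _ /asboolP[u [v [Ju pv ->]]]; apply: sub_thickened_ideal.
by rewrite mulrC addrC; apply: (proj2 (J_ideal n.+1)) => //; exact: J_incr.
Qed.

(** Both summands lie in the prime [p n], which does not contain [c n], so [c n] can be
    cancelled. *)
Lemma thickened_ideal_colon n a :
  (a * c n \in thickened_ideal n) = (a \in p n).
Proof.
have [[p0 _ pD] pM] := p_prime n.
apply/asboolP/idP => [[u [v [/Jp pu pv acE]]]|pa]; last first.
  by exists 0, a; split=> //; [case: (J_ideal n)|rewrite add0r mulrC].
have /pM : a * c n \in p n by rewrite acE addrC pD.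
by rewrite (negbTE (cp n)) orbF.
Qed.

(** For [m < n], the element [c m] separates the two primes: it lies in [J n], hence in [p n], but
    not in [p m]. *)
Lemma prime_chain_inj : injective p.
Proof.
have pc m n : (m < n)%N -> c m \in p n.
  move=> mn; apply: Jp; elim: n mn => // n IHn; rewrite ltnS leq_eqVlt.
  by move=> /predU1P[->|/IHn/J_incr].
by move=> m n pE; case: (ltngtP m n) => // /pc; rewrite ?pE;
  [rewrite -pE|]; rewrite (negbTE (cp _)).
Qed.

Lemma prime_chain_not_weakly_laskerian : ~ weakly_laskerian_ring {poly R}.
Proof.
have cI n : c n \in thickened_ideal n.+1 := sub_thickened_ideal (cJ n).
move=> wl; apply: (graded_quotient_Ass_infinite (I_incr := thickened_ideal_incr)
  cI thickened_ideal_colon p_prime prime_chain_inj).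
exact: wl.
Qed.

End PrimeChain.

Theorem theorem2p6 (R : comNzRingType) :
  weakly_laskerian_ring {poly R} -> noetherian_space (Spec R).
Proof.
move=> wl U U_open U_incr; apply: contrapT => U_not_stable.
have U_leq m n : (m <= n)%N -> (U m `<=` U n)%classic.
  apply: (homo_leq (r := subset) _ _ U_incr) => [A x //|B A C].
  exact: subset_trans.
have grows m : exists n, (m < n)%N /\ exists q, U n q /\ ~ U m q.
  apply: contrapT => /forallNP no; apply: U_not_stable; exists m => n mn.
  apply/seteqP; split=> [q Unq|]; last exact: U_leq.
  apply: contrapT => nUmq; apply: (no n.+1); split; first by rewrite ltnS.
  by exists q; split=> //; exact: (U_incr n).
have /choice[next /all_and2[next_gt nextP]] := grows.
have /choice[q /all_and2[qU qnU]] := nextP.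
(* Along the indices [N n] the open sets grow strictly, with [q (N n)] a point gained at each
   step. *)
pose N n := iter n next 0%N.
pose J n : {pred R} :=
  [pred a | `[< forall x : Spec R, ~ U (N n) x -> a \in sval x >]].
(* If [U (N n.+1)] is the complement of the zero locus of [E], then all of [E] lies in [J n.+1],
   while some element of [E] avoids the prime [q (N n)] of this open set. *)
have cP n : exists a, a \in J n.+1 /\ a \notin sval (q (N n)).
  have := U_open (N n.+1); rewrite Spec_openE => -[E UE].
  have := qU (N n); rewrite -[next _]/(N n.+1) UE => /existsNP[a].
  move=> /not_implyP[Ea /negP qa]; exists a; split=> //.
  by apply/asboolP => x; rewrite UE => /contrapT/(_ a Ea).
have /choice[c /all_and2[cJ cq]] := cP.
apply: (@prime_chain_not_weakly_laskerian R J (fun n => sval (q (N n))) c) wl.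
- move=> n; split=> [|a u v /asboolP Ju /asboolP Jv]; apply/asboolP => x Ux.
    by case: (svalP x) => -[].
  by case: (svalP x) => -[_ _ xD] _; apply: xD; [exact: Ju|exact: Jv].
- by move=> n; exact: svalP.
- move=> n a /asboolP Ja; apply/asboolP => x Ux; apply: Ja.
  by apply: contra_not Ux; apply: U_leq; exact: ltnW (next_gt _).
- by move=> n a /asboolP; apply; exact: qnU.
- exact: cJ.
- exact: cq.
Qed.
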